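(* Let $\Omega\subset\mathbb{R}^n$ be a Borel set and let $F\subset\overline{\Omega}$ be closed with $\mathcal{L}^n(F\cap\Omega)=0$. Furthermore, let $\lambda\in\mathrm{ba}(\Omega,\mathcal{B}(\Omega),\mathcal{L}^n)$ with $\lambda\geq0$ be such that $\lambda(F_\delta\cap\Omega)>0$ for all $\delta>0$. Then there exists a density measure $\mu\in\mathrm{ba}(\Omega,\mathcal{B}(\Omega),\mathcal{L}^n)$ for $F$ such that for every $f\in L^\infty(\Omega)$ $$\liminf_{\delta\downarrow0}\frac{1}{\lambda(F_\delta\cap\Omega)}\int_{F_\delta\cap\Omega}f\,d\lambda\;\leq\; ⨍_F f\,d\mu\;\leq\;\limsup_{\delta\downarrow0}\frac{1}{\lambda(F_\delta\cap\Omega)}\int_{F_\delta\cap\Omega}f\,d\lambda,$$ where the middle term denotes $\int_{F_\delta\cap\Omega}f\,d\mu$ for arbitrary $\delta>0$ (its value does not depend on $\delta$ and equals $\int_\Omega f\,d\mu$).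
   Context: $\mathcal{B}(\Omega)$ is the Borel $\sigma$-algebra of $\Omega$, $\mathcal{L}^n$ is Lebesgue measure and $L^\infty(\Omega)$ is the space of $\mathcal{L}^n$-essentially bounded functions on $\Omega$. A measure is a finitely additive real-valued set function. $\mathrm{ba}(\Omega,\mathcal{B}(\Omega),\mathcal{L}^n)$ is the set of bounded measures $\mu$ on $\mathcal{B}(\Omega)$ such that $\mathcal{L}^n(B)=0$ implies $\mu(B)=0$ for all $B\in\mathcal{B}(\Omega)$; order is setwise and $|\mu|$ is the total variation. For such $\mu$ and $f\in L^\infty(\Omega)$, $\int f\,d\mu:=\lim_k\int s_k\,d\mu$, where $s_k$ are simple functions converging to $f$ in measure $|\mu|$ (i.e. $|\mu|^*\{|s_k-f|>\varepsilon\}\to0$ for all $\varepsilon>0$, with $|\mu|^*(B)=\inf\{|\mu|(A):A\in\mathcal B(\Omega),B\subset A\}$) and with $\int_\Omega|s_k-s_l|\,d|\mu|\to0$; $\int_Bf\,d\mu:=\int_\Omega f\mathbf{1}_B\,d\mu$. $F_\delta$ denotes the open $\delta$-neighbourhood of $F$ in $\mathbb{R}^n$. A density measure for $F$ is a $\mu\in\mathrm{ba}(\Omega,\mathcal{B}(\Omega),\mathcal{L}^n)$ with $\mu\geq0$ and $\mu(F_\delta\cap\Omega)=\mu(\Omega)=1$ for all $\delta>0$. *)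

(* Defs.v *)
From mathcomp Require Import all_boot all_order all_algebra.
From mathcomp Require Import all_classical all_reals all_analysis.
Import Order.TTheory GRing.Theory Num.Theory.
Import numFieldNormedType.Exports.
Set Implicit Arguments.
Unset Strict Implicit.
Unset Printing Implicit Defensive.
Local Open Scope classical_set_scope.
Local Open Scope ring_scope.

Definition borel {X : topologicalType} : set_system X := <<s @open X >>.

Section euclidean_space.
Context {R : realType} {n : nat}.
Implicit Types (x y a b : 'rV[R]_n) (A F : set 'rV[R]_n).

(* The library norm on 'rV[R]_n is the sup norm; the neighbourhoods F_delta
   depend on the choice of the norm. *)
Definition eucl_norm x : R := Num.sqrt (\sum_(i < n) x 0 i ^+ 2).

Definition eucl_nbhd F (delta : R) : set 'rV[R]_n :=
  [set x | exists2 y, F y & eucl_norm (x - y) < delta].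

Definition box a b : set 'rV[R]_n :=
  [set x | forall i, a 0 i <= x 0 i <= b 0 i].

Definition box_volume a b : R := \prod_(i < n) Num.max 0 (b 0 i - a 0 i).

(* n-dimensional Lebesgue (outer) measure, by countable covers with boxes.
   The index set D may be empty, so that set0 has measure 0 also for n = 0. *)
Definition lebesgue_rV A : \bar R :=
  ereal_inf [set v | exists (D : set nat) (a b : nat -> 'rV[R]_n),
    A `<=` \bigcup_(k in D) box (a k) (b k) /\
    v = \esum_(k in D) (box_volume (a k) (b k))%:E].

End euclidean_space.

Section bounded_additive_measures.
Context {R : realType} {n : nat} {Omega : set 'rV[R]_n}.
(* The values of a set function outside of the Borel sets of Omega are
   irrelevant. *)
Implicit Types (mu : set Omega -> R) (A B : set Omega) (f s : Omega -> R).

Definition lebesgue_on B : \bar R := lebesgue_rV (set_val @` B).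

Definition finitely_additive mu : Prop := forall A B,
  borel A -> borel B -> A `&` B = set0 -> mu (A `|` B) = mu A + mu B.

Definition ba mu : Prop :=
  [/\ finitely_additive mu,
      exists M : R, forall B, borel B -> `|mu B| <= M &
      forall B, borel B -> lebesgue_on B = 0%E -> mu B = 0].

Definition nonneg_measure mu : Prop := forall B, borel B -> 0 <= mu B.

(* The supremum is finite when mu is bounded, as it is for mu in ba. *)
Definition total_variation mu A : R :=
  sup [set v | exists (m : nat) (P : 'I_m -> set Omega),
    [/\ forall i, borel (P i), trivIset setT P, \bigcup_i P i = A &
        v = \sum_(i < m) `|mu (P i)|]].

Definition outer_variation mu B : R :=
  inf [set total_variation mu A | A in [set A | borel A /\ B `<=` A]].

Definition simple_function s : Prop :=
  finite_set (range s) /\ forall x : R, borel (s @^-1` [set x]).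

Definition simple_integral mu s : R :=
  \sum_(x \in range s) x * mu (s @^-1` [set x]).

Definition cvg_in_variation mu (s : nat -> Omega -> R) f : Prop :=
  forall eps : R, 0 < eps ->
    outer_variation mu [set x | eps < `|s k x - f x|] @[k --> \oo] --> (0 : R).

Definition cauchy_in_mean mu (s : nat -> Omega -> R) : Prop :=
  forall eps : R, 0 < eps -> exists N : nat, forall k l : nat,
    (N <= k)%N -> (N <= l)%N ->
    simple_integral (total_variation mu) (fun x => `|s k x - s l x|) < eps.

Definition has_integral mu f (v : R) : Prop :=
  exists s : nat -> Omega -> R,
    [/\ forall k, simple_function (s k), cvg_in_variation mu s f,
        cauchy_in_mean mu s & simple_integral mu (s k) @[k --> \oo] --> v].

Definition integral_ba mu f : R := xget 0 [set v | has_integral mu f v].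

Definition integral_ba_on mu B f : R := integral_ba mu (f \* \1_B).

Definition borel_function f : Prop :=
  forall V : set R, borel V -> borel (f @^-1` V).

(* Lebesgue measurable, i.e. equal to a Borel function off a null set, and
   essentially bounded. *)
Definition Linfty f : Prop :=
  (exists2 g : Omega -> R,
     borel_function g & lebesgue_on [set x | f x != g x] = 0%E) /\
  (exists M : R, lebesgue_on [set x | M < `|f x|] = 0%E).

(* F_delta `&` Omega, as a subset of Omega. *)
Definition nbhd_on (F : set 'rV[R]_n) (delta : R) : set Omega :=
  [set x | eucl_nbhd F delta (set_val x)].

Definition density_measure (F : set 'rV[R]_n) mu : Prop :=
  [/\ ba mu, nonneg_measure mu, mu setT = 1 &
      forall delta : R, 0 < delta -> mu (nbhd_on F delta) = 1].

Definition average mu B f : R := (mu B)^-1 * integral_ba_on mu B f.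

End bounded_additive_measures.

(* Main.v *)
(* For d > 0 the normalised restrictions A |-> lambda(A `&` F_d) / lambda(F_d)
   take values in [0, 1], so they converge along an ultrafilter finer than the
   filter of right neighbourhoods of 0; the limit is mu. It is finitely
   additive, and it gives mass 1 to every F_delta because F_d is contained in
   F_delta for d <= delta. Off a Borel null set, f is a uniform limit of simple
   functions s_k, so both the averages of f and its mu-integral are uniformly
   (in d) within 1/(k+1) of the corresponding integrals of s_k, which are finite
   sums and converge termwise. Hence the averages of f converge along the
   ultrafilter to the mu-integral of f, which therefore lies between their lower
   and upper limits at 0. *)
Require Import Defs.
From mathcomp Require Import all_boot all_order all_algebra.
From mathcomp Require Import all_classical all_reals all_analysis.
From mathcomp Require Import finmap ring lra.
Import Order.TTheory GRing.Theory Num.Theory.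
Import numFieldNormedType.Exports.
Set Implicit Arguments.
Unset Strict Implicit.
Unset Printing Implicit Defensive.
Local Open Scope classical_set_scope.
Local Open Scope ring_scope.

(** * Closure properties of Borel sets *)

Section borel_sets.
Context {X : topologicalType}.
Implicit Types (A B : set X).

Lemma borel_open A : open A -> borel A.
Proof. exact: sub_sigma_algebra. Qed.

Lemma borel0 : borel (@set0 X).
Proof. exact: sigma_algebra0. Qed.

Lemma borelC A : borel A -> borel (~` A).
Proof. by move=> bA; rewrite -setTD; exact: sigma_algebraCD. Qed.

Lemma borelT : borel (@setT X).
Proof. by rewrite -setC0; apply: borelC; exact: borel0. Qed.

Lemma borel_closed A : closed A -> borel A.
Proof.
move=> cA; rewrite -(setCK A); apply: borelC; apply: borel_open.
exact: closed_openC.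
Qed.

Lemma borel_bigcup (F : nat -> set X) :
  (forall i, borel (F i)) -> borel (\bigcup_i F i).
Proof. exact: sigma_algebra_bigcup. Qed.

Lemma borel_bigcup_in (D : set nat) (F : nat -> set X) :
  (forall i, D i -> borel (F i)) -> borel (\bigcup_(i in D) F i).
Proof.
move=> bF; rewrite bigcup_mkcond; apply: borel_bigcup => i.
by case: ifPn => [/set_mem/bF//|_]; exact: borel0.
Qed.

Lemma borelU A B : borel A -> borel B -> borel (A `|` B).
Proof.
move=> bA bB; rewrite -bigcup2E; apply: borel_bigcup => -[|[|i]] //=.
exact: borel0.
Qed.

Lemma borelI A B : borel A -> borel B -> borel (A `&` B).
Proof.
move=> bA bB; rewrite -(setCK (A `&` B)) setCI.
by apply: borelC; apply: borelU; exact: borelC.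
Qed.

Lemma borel_bigcap (F : nat -> set X) :
  (forall i, borel (F i)) -> borel (\bigcap_i F i).
Proof.
move=> bF; rewrite -(setCK (\bigcap_i _)) setC_bigcap.
by apply: borelC; apply: borel_bigcup => i; exact: borelC.
Qed.

Lemma borel_fin_bigcup (I : choiceType) (D : set I) (F : I -> set X) :
  finite_set D -> (forall i, D i -> borel (F i)) -> borel (\bigcup_(i in D) F i).
Proof.
move=> fD bF; rewrite -bigsetU_fset_set//.
rewrite big_seq; apply: (big_ind borel) => [|A B|i]; [exact: borel0|exact: borelU|].
by rewrite in_fset_set// => /set_mem; exact: bF.
Qed.

End borel_sets.

(** The sets with Borel preimage form a sigma-algebra, and by continuity it contains the open
    sets. *)
Lemma borel_preimage (X Y : topologicalType) (g : X -> Y) (B : set Y) :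
  continuous g -> borel B -> borel (g @^-1` B).
Proof.
move=> cg bB; move: B bB.
have : sigma_algebra setT [set B : set Y | borel (g @^-1` B)].
  split => /=.
  - by rewrite preimage_set0; exact: borel0.
  - by move=> A bA; rewrite setTD preimage_setC; exact: borelC.
  - by move=> F bF; rewrite preimage_bigcup; exact: borel_bigcup.
move=> sa; apply: smallest_sub => // A oA /=.
by apply: borel_open; exact: open_comp.
Qed.

(** * Nonnegative finitely additive set functions and simple maps *)

Section nonneg_additive.
Context {R : realType} {n : nat} {Omega : set 'rV[R]_n}.
Implicit Types (mu : set Omega -> R) (A B : set Omega).

Definition nonneg_additive mu := finitely_additive mu /\ nonneg_measure mu.

Section nonneg_additive_theory.
Variable mu : set Omega -> R.
Hypothesis cmu : nonneg_additive mu.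

Let additive := cmu.1.
Let nonneg := cmu.2.

Lemma nonneg_additive0 : mu set0 = 0.
Proof.
have := additive borel0 borel0 (setI0 _); rewrite setU0 => /eqP.
by rewrite -subr_eq0 opprD addrA subrr sub0r oppr_eq0 => /eqP.
Qed.

Lemma nonneg_additiveD A B : borel A -> borel B -> A `<=` B ->
  mu B = mu A + mu (B `\` A).
Proof.
move=> bA bB AB; rewrite -additive //; last by rewrite setDE setICA setICr setI0.
  by rewrite setDUK.
by rewrite setDE; apply: borelI => //; exact: borelC.
Qed.

Lemma nonneg_additive_le A B : borel A -> borel B -> A `<=` B -> mu A <= mu B.
Proof.
move=> bA bB AB; rewrite (nonneg_additiveD bA bB AB) lerDl; apply: nonneg.
by rewrite setDE; apply: borelI => //; exact: borelC.
Qed.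

Lemma nonneg_additiveU_le A B : borel A -> borel B -> mu (A `|` B) <= mu A + mu B.
Proof.
move=> bA bB; rewrite (@nonneg_additiveD A _ bA (borelU bA bB) (@subsetUl _ _ _)).
rewrite lerD2l; apply: nonneg_additive_le => //; last first.
  by rewrite setDUl setDv set0U; exact: subDsetl.
by rewrite setDE; apply: borelI; [exact: borelU|exact: borelC].
Qed.

(** Indexing by a duplicate-free list serves both the partitions in [total_variation] and the finite
    sets of values of simple maps. *)
Lemma nonneg_additive_bigcup_seq (I : choiceType) (r : seq I) (P : I -> set Omega) :
  uniq r -> (forall i, borel (P i)) -> trivIset [set` r] P ->
  mu (\bigcup_(i in [set` r]) P i) = \sum_(i <- r) mu (P i).
Proof.
move=> + bP; elim: r => [_ _|i r IH].
  by rewrite big_nil set_nil bigcup_set0 nonneg_additive0.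
rewrite cons_uniq => /andP[ir ur] tP.
rewrite big_cons -IH //; last first.
  by apply: sub_trivIset tP => j /= jr; rewrite inE jr orbT.
rewrite (_ : [set` i :: r] = i |` [set` r]); last first.
  by apply/seteqP; split => j /=; rewrite inE => /predU1P.
rewrite bigcup_setU1 additive //.
  by apply: borel_fin_bigcup => //; exact: finite_seq.
apply/seteqP; split => // x [Pix [j /= jr Pjx]].
have ij : i = j.
  apply: tP; [exact: mem_head|by rewrite /= inE jr orbT|by exists x].
by move: ir; rewrite ij jr.
Qed.

(** By additivity every finite Borel partition of [A] gives the same sum, so the supremum is taken
    over a singleton. *)
Lemma total_variation_nonneg_additive A : borel A ->
  Defs.total_variation mu A = mu A.
Proof.
move=> bA; rewrite /Defs.total_variation.
set S := [set v | _]; suff -> : S = [set mu A] by rewrite sup1.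
apply/seteqP; split => v.
  move=> [m [P [bP tP PA ->]]] /=.
  rewrite -PA (_ : setT = [set` index_enum 'I_m]); last first.
    by apply/seteqP; split => // i _ /=; rewrite mem_index_enum.
  rewrite nonneg_additive_bigcup_seq //; last exact: sub_trivIset tP.
    by apply: eq_bigr => i _; rewrite ger0_norm // nonneg.
  exact: index_enum_uniq.
move=> /= ->; exists 1%N, (fun=> A); split => //.
- by apply/trivIsetP => i j _ _; rewrite !ord1 eqxx.
- by rewrite bigcup_const //; exists ord0.
- by rewrite big_ord1 ger0_norm // nonneg.
Qed.

(* For T = R this is [simple_function]; the general codomain allows common
   refinements of several simple functions. *)
Definition simple_map (T : Type) (w : Omega -> T) : Prop :=
  finite_set (range w) /\ forall t, borel (w @^-1` [set t]).

Lemma simple_map_preimage (T : choiceType) (w : Omega -> T) (P : set T) :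
  simple_map w -> borel (w @^-1` P).
Proof.
move=> [fw bw].
rewrite (_ : w @^-1` P = \bigcup_(t in range w `&` P) w @^-1` [set t]).
  by apply: borel_fin_bigcup => //; exact: finite_setIl.
apply/seteqP; split => [x Px|x [t [_ Pt] /= ->]] //.
by exists (w x) => //; split => //; exists x.
Qed.

(** The sum runs over all values of [w], with weights 0 or 1, so that its index set does not depend
    on [P]; this permits the exchange of sums in [simple_integral_comp]. *)
Lemma nonneg_additive_preimage (T : choiceType) (w : Omega -> T) (P : set T) :
  simple_map w ->
  mu (w @^-1` P) =
  \sum_(t \in range w) (t \in P)%:R * mu (w @^-1` [set t]).
Proof.
move=> [fw bw].
have fwP : finite_set (range w `&` P) by exact: finite_setIl.
rewrite (_ : w @^-1` P =
  \bigcup_(t in [set` fset_set (range w `&` P)]) w @^-1` [set t]).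
  rewrite nonneg_additive_bigcup_seq //; last first.
    by move=> s t _ _ [x [/= -> ->]].
  rewrite -fsbig_finite // fsbig_mkcondr; apply: eq_fsbigr => t _.
  by case: ifPn => _; rewrite ?mul1r ?mul0r.
rewrite fset_setK //.
apply/seteqP; split => [x Px|x [t [_ Pt] /= ->]] //.
by exists (w x) => //; split => //; exists x.
Qed.

(** Each fibre of [phi \o w] is a finite union of fibres of [w]. When [w] pairs two simple
    functions, both integrals become sums over one index set and can be compared or added
    termwise. *)
Lemma simple_integral_comp (T : choiceType) (w : Omega -> T) (phi : T -> R) :
  simple_map w ->
  simple_integral mu (phi \o w) =
  \sum_(t \in range w) phi t * mu (w @^-1` [set t]).
Proof.
move=> sw; have [fw bw] := sw.
have fpw : finite_set (range (phi \o w)).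
  by rewrite -(image_comp w phi); exact: (finite_image phi fw).
rewrite /simple_integral.
under eq_fsbigr => x _.
  rewrite (_ : _ @^-1` _ = w @^-1` (phi @^-1` [set x])) //.
  rewrite nonneg_additive_preimage //.
  rewrite mulr_fsumr //.
over.
rewrite exchange_fsbig //; apply: eq_fsbigr => t /set_mem[z _ wz].
(* For fixed [t], only the value [phi t] contributes to the inner sum. *)
rewrite -(@fsbig_widen _ _ _ _ [set phi t]).
- by rewrite fsbig_set1 mem_set // mul1r.
- by move=> _ ->; exists z => //=; rewrite wz.
- move=> y [_ /= yt]; rewrite memNset ?mul0r ?mulr0 //= => e; exact: yt.
Qed.

Lemma simple_map_comp (T U : choiceType) (w : Omega -> T) (phi : T -> U) :
  simple_map w -> simple_map (phi \o w).
Proof.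
move=> sw; split.
  by rewrite -(image_comp w phi); exact: (finite_image phi sw.1).
by move=> u; exact: (simple_map_preimage (phi @^-1` [set u]) sw).
Qed.

Lemma simple_map_pair (T U : choiceType) (w : Omega -> T) (v : Omega -> U) :
  simple_map w -> simple_map v -> simple_map (fun x => (w x, v x)).
Proof.
move=> [fw bw] [fv bv]; split.
  apply: (@sub_finite_set _ _ (range w `*` range v)); last exact: finite_setX.
  by move=> _ [x _ <-]; split => /=; exists x.
move=> [t u]; rewrite (_ : _ @^-1` _ = w @^-1` [set t] `&` v @^-1` [set u]).
  exact: borelI.
by apply/seteqP; split => x /= [<- <-].
Qed.

Lemma simple_map_mem A : borel A -> simple_map (fun x => x \in A).
Proof.
move=> bA; split; first exact: finite_finset.
case.
  rewrite (_ : _ @^-1` _ = A) //.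
  by apply/seteqP; split => x; [exact: set_mem|exact: mem_set].
rewrite (_ : _ @^-1` _ = ~` A); first exact: borelC.
by apply/seteqP; split => x /=; [move=> xA /mem_set; rewrite xA|exact: memNset].
Qed.

Lemma simple_map_cst (T : choiceType) (c : T) : simple_map (fun=> c).
Proof. exact: (simple_map_comp (fun=> c) (simple_map_mem borelT)). Qed.

Lemma simple_map_indic A : borel A -> simple_map (\1_A : Omega -> R).
Proof.
move=> bA.
exact: (simple_map_comp (fun b : bool => b%:R : R) (simple_map_mem bA)).
Qed.

Lemma simple_map_comp2 (T U V : choiceType) (phi : T -> U -> V)
    (w : Omega -> T) (v : Omega -> U) :
  simple_map w -> simple_map v -> simple_map (fun x => phi (w x) (v x)).
Proof.
move=> sw sv.
exact: (simple_map_comp (fun p => phi p.1 p.2) (simple_map_pair sw sv)).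
Qed.

(** * Values, monotonicity and linearity of the simple integral *)

(** Summing over the fibres of a membership map also covers an empty [Omega], where the range is
    empty and both sides vanish. *)
Lemma simple_integral_cst (c : R) : simple_integral mu (fun=> c) = c * mu setT.
Proof.
have sT := simple_map_mem borelT.
rewrite (simple_integral_comp (fun=> c) sT).
rewrite (_ : mu setT = mu ((fun x => x \in [set: Omega]) @^-1` setT)) //.
rewrite (nonneg_additive_preimage setT sT) mulr_fsumr; apply: eq_fsbigr => b _.
by rewrite mem_set // mul1r.
Qed.

Lemma simple_integral_indic A : borel A -> simple_integral mu \1_A = mu A.
Proof.
move=> bA; have sA := simple_map_mem bA.
rewrite (simple_integral_comp (fun b : bool => b%:R : R) sA).
rewrite [in RHS](_ : A = (fun x => x \in A) @^-1` [set true]); last first.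
  by apply/seteqP; split => x; [exact: mem_set|exact: set_mem].
rewrite (nonneg_additive_preimage [set true] sA); apply: eq_fsbigr => -[] _.
  by rewrite mem_set.
by rewrite memNset.
Qed.

Lemma simple_integral_le (s t : Omega -> R) :
  simple_map s -> simple_map t -> (forall x, s x <= t x) ->
  simple_integral mu s <= simple_integral mu t.
Proof.
move=> ss st le_st; have sw := simple_map_pair ss st; have [fw bw] := sw.
rewrite (simple_integral_comp fst sw) (simple_integral_comp snd sw).
rewrite !fsbig_finite //= big_seq [leRHS]big_seq.
apply: ler_sum => p; rewrite in_fset_set // => /set_mem[x _ <-] /=.
by rewrite ler_wpM2r // nonneg.
Qed.

Lemma simple_integralD (s t : Omega -> R) : simple_map s -> simple_map t ->
  simple_integral mu (fun x => s x + t x) =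
  simple_integral mu s + simple_integral mu t.
Proof.
move=> ss st; have sw := simple_map_pair ss st; have [fw bw] := sw.
rewrite (simple_integral_comp fst sw) (simple_integral_comp snd sw).
rewrite (simple_integral_comp (fun p => p.1 + p.2) sw) -fsbig_split //.
by apply: eq_fsbigr => p _; rewrite mulrDl.
Qed.

Lemma simple_integralZ (c : R) (s : Omega -> R) : simple_map s ->
  simple_integral mu (fun x => c * s x) = c * simple_integral mu s.
Proof.
move=> ss; rewrite (simple_integral_comp (fun y => c * y) ss) mulr_fsumr.
by apply: eq_fsbigr => p _; rewrite mulrA.
Qed.

Lemma ler_norm_simple_integralB (s t : Omega -> R) :
  simple_map s -> simple_map t ->
  `|simple_integral mu s - simple_integral mu t| <=
  simple_integral mu (fun x => `|s x - t x|).
Proof.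
move=> ss st.
have sd := simple_map_comp2 (fun y z => `|y - z|) ss st.
have le_add u v : simple_map u -> simple_map v ->
    simple_integral mu u <=
    simple_integral mu (fun x => `|u x - v x|) + simple_integral mu v.
  move=> su sv; have sd' := simple_map_comp2 (fun y z => `|y - z|) su sv.
  rewrite -simple_integralD //; apply: simple_integral_le => //.
    exact: (simple_map_comp2 +%R sd' sv).
  by move=> x; rewrite -lerBlDr ler_norm.
rewrite ler_norml lerBlDr le_add // andbT lerBrDr addrC lerBlDr addrC.
by under eq_fun do rewrite distrC; exact: le_add.
Qed.

Lemma ler_dist_simple_integral (c : R) (s t : Omega -> R) :
  simple_map s -> simple_map t -> (forall x, `|s x - t x| <= c) ->
  `|simple_integral mu s - simple_integral mu t| <= c * mu setT.
Proof.
move=> ss st stc; apply: le_trans (ler_norm_simple_integralB ss st) _.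
rewrite -simple_integral_cst; apply: simple_integral_le => //.
  exact: (simple_map_comp2 (fun y z => `|y - z|) ss st).
exact: simple_map_cst.
Qed.

(** * Total variation, outer variation and uniqueness of the integral *)

Lemma simple_integral_total_variation (s : Omega -> R) : simple_map s ->
  simple_integral (Defs.total_variation mu) s = simple_integral mu s.
Proof.
move=> [_ bs]; apply: eq_fsbigr => x _.
by rewrite total_variation_nonneg_additive.
Qed.

Lemma outer_variation_null A B :
  borel A -> mu A = 0 -> B `<=` A -> outer_variation mu B = 0.
Proof.
move=> bA A0 BA; apply/eqP; rewrite eq_le; apply/andP; split.
  rewrite /outer_variation -A0 -(total_variation_nonneg_additive bA).
  apply: ge_inf; last by exists A.
  by exists 0 => _ [C [bC _] <-]; rewrite total_variation_nonneg_additive // nonneg.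
apply: lb_le_inf; first by exists (Defs.total_variation mu A), A.
by move=> _ [C [bC _] <-]; rewrite total_variation_nonneg_additive // nonneg.
Qed.

Lemma outer_variation_lt (e : R) B : outer_variation mu B < e ->
  exists A, [/\ borel A, B `<=` A & mu A < e].
Proof.
move=> /inf_lt[|_ [A [bA BA] <-] Ae].
  by exists (Defs.total_variation mu setT), setT => //; split=> //; exact: borelT.
by exists A; split=> //; rewrite -total_variation_nonneg_additive.
Qed.

Lemma simple_map_bounded (s : Omega -> R) : simple_map s ->
  exists2 C : R, 0 <= C & forall x, `|s x| <= C.
Proof.
move=> [fs _]; exists (\sum_(y <- fset_set (range s)) `|y|).
  exact: sumr_ge0.
move=> x; rewrite (bigD1_seq (s x)) //=.
  by rewrite lerDl sumr_ge0.
  by rewrite in_fset_set //; apply/mem_set; exists x.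
exact: fset_uniq.
Qed.

(* If h = |s_k - t_k|, then h tends to 0 in measure and is Cauchy in mean, so
   for a large fixed N, I(h_k) is controlled by I(|h_k - h_N|), by the values
   of the bounded function h_N on a small set, and by e mu(Omega). *)
Lemma has_integral_unique (f : Omega -> R) (v v' : R) :
  has_integral mu f v -> has_integral mu f v' -> v = v'.
Proof.
move=> [s [ss cs ms vs]] [t [st ct mt vt]].
have T0 : 0 <= mu setT by apply: nonneg; exact: borelT.
(* The 6 counts errors of size [e]: one for each limit [v] and [v'], one for each mean distance to
   index [N], and one for each of [C * mu A] and [C * mu B]. The term [e * mu setT] comes from the
   points outside [A] and [B]. *)
suff bound (e : R) : 0 < e -> `|v - v'| <= e * (6 + mu setT).
  apply/eqP; rewrite -subr_eq0 -normr_le0; apply/ler_addgt0Pl => e e0.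
  rewrite addr0; have c0 : 0 < 6 + mu setT by lra.
  by rewrite -(divfK (lt0r_neq0 c0) e); apply: bound; exact: divr_gt0.
move=> e0.
have [N1 hN1] := ms _ e0; have [N2 hN2] := mt _ e0.
pose N := maxn N1 N2.
have simpleB (u w : Omega -> R) : simple_map u -> simple_map w ->
    simple_map (fun x => `|u x - w x| : R).
  by move=> su sw; exact: (simple_map_comp2 (fun y z => `|y - z|) su sw).
have [C C0 hC] := simple_map_bounded (simpleB (s N) (t N) (ss N) (st N)).
(* [C] may be 0; a bound [e / (C + 1)] on [mu A] and [mu B] is well defined and still gives
   [C * mu A <= e] and [C * mu B <= e]. *)
have C1 : 0 < C + 1 by lra.
have d0 : 0 < e / (C + 1) by exact: divr_gt0.
have e20 : 0 < e / 2 by exact: divr_gt0.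
near \oo => k.
have kN : (N <= k)%N by near: k; exact: nbhs_infty_ge.
have [A [bA sA lA]] : exists A, [/\ borel A,
    [set x | e / 2 < `|s k x - f x|] `<=` A & mu A < e / (C + 1)].
  by apply: outer_variation_lt; near: k; exact: cvgr_lt (cs _ e20) _ d0.
have [B [bB sB lB]] : exists B, [/\ borel B,
    [set x | e / 2 < `|t k x - f x|] `<=` B & mu B < e / (C + 1)].
  by apply: outer_variation_lt; near: k; exact: cvgr_lt (ct _ e20) _ d0.
have Is : `|v - simple_integral mu (s k)| <= e.
  by near: k; exact: cvgr_dist_le vs _ e0.
have It : `|v' - simple_integral mu (t k)| <= e.
  by near: k; exact: cvgr_dist_le vt _ e0.
have mean_s := hN1 k N (leq_trans (leq_maxl _ _) kN) (leq_maxl _ _).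
have mean_t := hN2 k N (leq_trans (leq_maxr _ _) kN) (leq_maxr _ _).
rewrite simple_integral_total_variation in mean_s;
  last exact: (simpleB _ _ (ss k) (ss N)).
rewrite simple_integral_total_variation in mean_t;
  last exact: (simpleB _ _ (st k) (st N)).
have Ist := ler_norm_simple_integralB (ss k) (st k).
pose u1 := fun x => `|s k x - s N x|.
pose u2 := fun x => `|t k x - t N x|.
pose u3 : Omega -> R := fun x => C * \1_A x.
pose u4 : Omega -> R := fun x => C * \1_B x.
have s1 : simple_map u1 by exact: (simpleB _ _ (ss k) (ss N)).
have s2 : simple_map u2 by exact: (simpleB _ _ (st k) (st N)).
have s3 : simple_map u3.
  exact: (simple_map_comp (fun y => C * y) (simple_map_indic bA)).
have s4 : simple_map u4.
  exact: (simple_map_comp (fun y => C * y) (simple_map_indic bB)).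
have s5 : simple_map (fun=> e : R) by exact: simple_map_cst.
have s12 := simple_map_comp2 +%R s1 s2.
have s123 := simple_map_comp2 +%R s12 s3.
have s1234 := simple_map_comp2 +%R s123 s4.
(* On [A] or [B] the estimate passes through index [N], where the difference is at most [C];
   elsewhere [s k] and [t k] are both within [e / 2] of [f]. *)
have I_le : simple_integral mu (fun x => `|s k x - t k x|) <=
    simple_integral mu (fun x => u1 x + u2 x + u3 x + u4 x + e).
  apply: simple_integral_le; first exact: (simpleB _ _ (ss k) (st k)).
    exact: (simple_map_comp2 +%R s1234 s5).
  move=> x; rewrite /u1 /u2 /u3 /u4 !indicE.
  have hN := hC x; rewrite normr_id in hN.
  have tri : `|s k x - t k x| <=
      `|s k x - s N x| + `|t k x - t N x| + `|s N x - t N x|.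
    rewrite (_ : s k x - t k x =
      (s k x - s N x) - (t k x - t N x) + (s N x - t N x)); last by ring.
    by apply: le_trans (ler_normD _ _) _; rewrite lerD2r ler_normB.
  have n1 := normr_ge0 (s k x - s N x); have n2 := normr_ge0 (t k x - t N x).
  case: (boolP (x \in A)) => [_|/negP xA] /=.
    by case: (x \in B) => /=; lra.
  case: (boolP (x \in B)) => [_|/negP xB] /=; first by lra.
  have sk : `|s k x - f x| <= e / 2.
    by rewrite leNgt; apply/negP => h; apply: xA; apply: mem_set; exact: sA.
  have tk : `|t k x - f x| <= e / 2.
    by rewrite leNgt; apply/negP => h; apply: xB; apply: mem_set; exact: sB.
  have tri' : `|s k x - t k x| <= `|s k x - f x| + `|t k x - f x|.
    rewrite (_ : s k x - t k x = (s k x - f x) - (t k x - f x)); last by ring.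
    exact: ler_normB.
  lra.
rewrite !simple_integralD // simple_integral_cst !simple_integralZ // in I_le;
  try exact: simple_map_indic.
rewrite !simple_integral_indic // in I_le.
have CA : C * mu A <= e.
  have := ler_wpM2l C0 (ltW lA); move=> /le_trans; apply.
  by rewrite mulrA ler_pdivrMr // mulrC ler_wpM2l ?ltW //; lra.
have CB : C * mu B <= e.
  have := ler_wpM2l C0 (ltW lB); move=> /le_trans; apply.
  by rewrite mulrA ler_pdivrMr // mulrC ler_wpM2l ?ltW //; lra.
have : `|v - v'| <= `|v - simple_integral mu (s k)| +
    `|v' - simple_integral mu (t k)| +
    `|simple_integral mu (s k) - simple_integral mu (t k)|.
  rewrite (_ : v - v' = (v - simple_integral mu (s k)) -
    (v' - simple_integral mu (t k)) +
    (simple_integral mu (s k) - simple_integral mu (t k))); last by ring.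
  by apply: le_trans (ler_normD _ _) _; rewrite lerD2r ler_normB.
rewrite /u1 /u2 in I_le; nra.
Unshelve. all: by end_near. Qed.
End nonneg_additive_theory.
End nonneg_additive.

(** * Boxes and Euclidean neighbourhoods *)

Section euclidean_sets.
Context {R : realType} {n : nat}.

Lemma closed_box (a b : 'rV[R]_n) : closed (box a b).
Proof.
rewrite (_ : box a b = \bigcap_(i in @setT 'I_n)
    ((fun x : 'rV[R]_n => x 0 i) @^-1` [set y | a 0 i <= y] `&`
     (fun x : 'rV[R]_n => x 0 i) @^-1` [set y | y <= b 0 i])); last first.
  apply/seteqP; split => [x abx i _ /=|x abx i]; first exact/andP/abx.
  exact/andP/abx.
apply: closed_bigI => i _.
apply: closedI; apply: preimage_closed.
- by move=> x _; exact: coord_continuous.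
- exact: closed_ge.
- by move=> x _; exact: coord_continuous.
- exact: closed_le.
Qed.

(** Continuity is meant for the sup-norm topology of ['rV[R]_n]; it makes Euclidean neighbourhoods
    open there. *)
Lemma eucl_norm_continuous : continuous (@eucl_norm R n).
Proof.
move=> x; apply: (continuous_comp _ (@sqrt_continuous R _)).
apply: continuous_big; first exact: add_continuous.
move=> i _ y; apply: (continuous_comp _ (@exprn_continuous R 2 _)).
exact: coord_continuous.
Qed.

Lemma open_eucl_nbhd (F : set 'rV[R]_n) (d : R) : open (eucl_nbhd F d).
Proof.
rewrite (_ : eucl_nbhd F d = \bigcup_(y in F)
    ((fun x => eucl_norm (x - y)) @^-1` [set r | r < d])); last first.
  by apply/seteqP; split => x [y Fy xy]; exists y.
apply: bigcup_open => y _; apply: open_comp; last exact: open_lt.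
move=> x _.
have cB : {for x, continuous (fun z : 'rV[R]_n => z - y)}.
  exact: cvgB cvg_id (cvg_cst y).
exact: (continuous_comp cB (@eucl_norm_continuous (x - y))).
Qed.

Lemma eucl_nbhd_subset (F : set 'rV[R]_n) (d e : R) :
  d <= e -> eucl_nbhd F d `<=` eucl_nbhd F e.
Proof. by move=> de x [y Fy xy]; exists y => //; exact: lt_le_trans de. Qed.

End euclidean_sets.

(** * Borel subsets of [Omega] and Borel hulls of null sets *)

Section null_sets.
Context {R : realType} {n : nat} {Omega : set 'rV[R]_n}.

Lemma set_val_continuous : continuous (set_val : Omega -> 'rV[R]_n).
Proof. exact: initial_continuous. Qed.

Lemma borel_nbhd_on (F : set 'rV[R]_n) (d : R) :
  borel (nbhd_on F d : set Omega).
Proof.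
apply: (borel_preimage set_val_continuous).
by apply: borel_open; exact: open_eucl_nbhd.
Qed.

(** The hull is an intersection of box covers with total volumes tending to 0. It is used because
    [Linfty] provides arbitrary null sets, while [ba] speaks only of Borel ones. *)
Lemma lebesgue_on_null_cover (B : set Omega) : lebesgue_on B = 0%E ->
  exists N : set Omega, [/\ borel N, B `<=` N & lebesgue_on N = 0%E].
Proof.
rewrite /lebesgue_on /lebesgue_rV => B0.
pose V (A : set 'rV[R]_n) := [set v | exists (D : set nat) (a b : nat -> 'rV[R]_n),
  A `<=` \bigcup_(k in D) box (a k) (b k) /\
  v = \esum_(k in D) (box_volume (a k) (b k))%:E].
(* The last clause records that the cover behind [U] serves every subset of [U] at the same volume,
   in particular the final intersection. *)
have /choice[U hU] : forall j : nat, exists U : set 'rV[R]_n,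
    [/\ borel U, set_val @` B `<=` U &
     exists2 v, (v < (j.+1%:R^-1)%:E)%E & forall A, A `<=` U -> V A v].
  move=> j.
  have : (ereal_inf (V (set_val @` B)) < (j.+1%:R^-1)%:E)%E.
    by rewrite B0 lte_fin invr_gt0.
  move=> /ereal_inf_lt[v [D [a [b [Bab vE]]]] vj].
  exists (\bigcup_(k in D) box (a k) (b k)); split => //.
    by apply: borel_bigcup_in => k _; apply: borel_closed; exact: closed_box.
  by exists v => // A AU; exists D, a, b.
exists (\bigcap_j set_val @^-1` (U j)); split.
- apply: borel_bigcap => j; apply: (borel_preimage set_val_continuous).
  by have [] := hU j.
- by move=> x Bx j _ /=; have [_ + _] := hU j; apply; exists x.
apply/eqP; rewrite eq_le; apply/andP; split; last first.
  apply: le_ereal_inf_tmp => _ [D [a [b [_ ->]]]].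
  apply: esum_ge0 => k _; rewrite lee_fin; apply: prodr_ge0 => i _.
  by rewrite le_max lexx.
apply/lee_addgt0Pr => e e0; rewrite add0e.
(* [Num.bound e^-1] exceeds [e^-1], so at this index the volume is below [e]. *)
have [_ _ [v vj hv]] := hU (Num.bound e^-1).
apply: (@le_trans _ _ v).
  apply: ereal_inf_lbound; apply: hv => _ [x Nx <-].
  exact: Nx.
apply: le_trans (ltW vj) _; rewrite lee_fin invf_ple ?posrE //.
have := archi_boundP (ltW (_ : 0 < e^-1)); rewrite invr_gt0 => /(_ e0)/ltW.
by move=> /le_trans; apply; rewrite ler_nat.
Qed.

End null_sets.

(** * Uniform approximation by simple functions off a null set *)

Section uniform_approximation.
Context {R : realType} {n : nat} {Omega : set 'rV[R]_n}.
Implicit Types (mu : set Omega -> R) (f : Omega -> R) (s : nat -> Omega -> R).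

Lemma ba_nonneg_additive mu : ba mu -> nonneg_measure mu -> nonneg_additive mu.
Proof. by move=> [? _ _]. Qed.

(* [N] is null for all measures at once, so that one sequence [s] serves both
   lambda and mu; stating this instead of [lebesgue_on N = 0] avoids proving
   subadditivity of the Lebesgue outer measure. *)
Definition uniform_approx f s : Prop := exists (N : set Omega) (g : Omega -> R),
  [/\ borel N, forall mu, ba mu -> nonneg_measure mu -> mu N = 0,
      forall x, ~ N x -> f x = g x, forall k, simple_map (s k) &
      forall k x, `|s k x - g x| <= k.+1%:R^-1].

(** Adding [M] makes the argument of [Num.trunc] nonnegative, so truncation is the floor: the fibre
    over [Some j] is the preimage of the half-open interval from [j / c - M] to [(j + 1) / c - M],
    cut down to the points where [g] is bounded by [M]. This bound also leaves finitely many values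
    of [j]. *)
Lemma simple_map_quantize (g : Omega -> R) (M c : R) : 0 < c -> borel_function g ->
  simple_map (fun x => if `|g x| <= M then
    Some (Num.trunc (c * (g x + M))) else None).
Proof.
move=> c0 bg; split.
  apply: (@sub_finite_set _ _
    (Some @` `I_(Num.trunc (c * (M + M))).+1 `|` [set None])); last first.
    by rewrite finite_setU; split; [exact/finite_image/finite_II|exact: finite_set1].
  move=> _ [x _ <-]; case: ifPn => gM; [left|by right].
  exists (Num.trunc (c * (g x + M))) => //=; rewrite ltnS.
  apply: le_truncn; rewrite ler_pM2l // lerD2r.
  exact: le_trans (ler_norm _) gM.
have bM : borel (g @^-1` [set y | `|y| <= M]).
  apply: bg; rewrite (_ : [set y | _] = [set y | -M <= y] `&` [set y | y <= M]).
    by apply: borel_closed; apply: closedI; [exact: closed_ge|exact: closed_le].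
  by apply/seteqP; split => y /=; rewrite ler_norml => /andP.
case=> [j|]; last first.
  rewrite (_ : _ @^-1` _ = ~` (g @^-1` [set y | `|y| <= M])); first exact: borelC.
  by apply/seteqP; split => x /=; case: ifPn => // /negP.
rewrite (_ : _ @^-1` _ = (g @^-1` [set y | `|y| <= M]) `&`
  (g @^-1` [set y | j%:R / c - M <= y] `&` g @^-1` [set y | y < j.+1%:R / c - M])).
  apply: borelI => //; apply: borelI; apply: bg.
    by apply: borel_closed; exact: closed_ge.
  by apply: borel_open; exact: open_lt.
have iff_j x : `|g x| <= M -> (Num.trunc (c * (g x + M)) == j) =
    (j%:R / c - M <= g x < j.+1%:R / c - M).
  move=> gM; have g0 : 0 <= c * (g x + M).
    apply: mulr_ge0; first exact: ltW.
    by rewrite -lerBlDr sub0r lerNl (le_trans _ gM) // -normrN ler_norm.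
  rewrite truncn_eq // lerBlDr ltrBrDr ler_pdivrMr //.
  by rewrite ltr_pdivlMr // ![_ * c]mulrC.
apply/seteqP; split => x /=.
  by case: ifPn => // gM [/eqP]; rewrite iff_j // => /andP.
by move=> [gM [g1 g2]]; rewrite gM; congr Some; apply/eqP; rewrite iff_j // g1.
Qed.

(** A Borel representative is rounded down to the grid of mesh [k.+1%:R^-1] that starts at [-M];
    [phi k] turns the grid index back into a grid point. *)
Lemma Linfty_uniform_approx f : Linfty f -> exists s, uniform_approx f s.
Proof.
move=> [[g bg /lebesgue_on_null_cover[N1 [bN1 sN1 N10]]]].
move=> [M /lebesgue_on_null_cover[N2 [bN2 sN2 N20]]].
pose w k x := if `|g x| <= M then
  Some (Num.trunc (k.+1%:R * (g x + M))) else None.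
pose phi k o : R := if o is Some j then j%:R / k.+1%:R - M else 0.
(* Setting [g] to 0 where it exceeds [M] in absolute value changes nothing off the null set: there
   [f] equals [g] and is bounded by [M]. *)
exists (fun k => phi k \o w k), (N1 `|` N2),
  (fun x => if `|g x| <= M then g x else 0); split.
- exact: borelU.
- move=> mu bamu mu0; have [_ _ null] := bamu.
  have cmu := ba_nonneg_additive bamu mu0.
  apply/eqP; rewrite eq_le mu0 ?andbT; last exact: borelU.
  by apply: le_trans (nonneg_additiveU_le cmu bN1 bN2) _; rewrite !null ?addr0.
- move=> x /not_orP[N1x N2x].
  have fg : f x = g x.
    by apply/eqP/contraT => fg; exfalso; apply: N1x; exact: sN1.
  rewrite -fg ifT // leNgt; apply/negP => Mf.
  by apply: N2x; exact: sN2.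
- by move=> k; apply: simple_map_comp; exact: simple_map_quantize.
- move=> k x /=; rewrite /w; case: ifPn => gM /=; last first.
    by rewrite subrr normr0 invr_ge0.
  have k0 : 0 < k.+1%:R :> R by [].
  have g0 : 0 <= k.+1%:R * (g x + M).
    apply: mulr_ge0; first exact: ltW.
    by rewrite -lerBlDr sub0r lerNl (le_trans _ gM) // -normrN ler_norm.
  have /andP[t1 t2] := truncn_itv g0.
  move: t1 t2; set j := Num.trunc _.
  rewrite -ler_pdivrMl // -ltr_pdivlMl // -[j.+1%:R]natr1 mulrDr mulr1.
  rewrite [_^-1 * _]mulrC => t1 t2; rewrite distrC opprB addrA.
  by rewrite ger0_norm ?subr_ge0 // lerBlDl ltW.
Qed.

End uniform_approximation.

(** * Integrals of uniform limits of simple functions *)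

Section integral_of_uniform_limits.
Context {R : realType} {n : nat} {Omega : set 'rV[R]_n}.
Implicit Types (mu : set Omega -> R) (f : Omega -> R) (s : nat -> Omega -> R).

Lemma near_invnS_lt (e : R) : 0 < e -> \forall k \near \oo, k.+1%:R^-1 < e.
Proof. by move=> e0; exact: (cvgr_lt _ (@cvg_harmonic R) _ e0). Qed.

Lemma uniform_approx_dist f s : uniform_approx f s ->
  forall k l x, `|s k x - s l x| <= k.+1%:R^-1 + l.+1%:R^-1.
Proof.
move=> [N [g [_ _ _ _ sg]]] k l x.
rewrite (_ : s k x - s l x = (s k x - g x) - (s l x - g x)); last by ring.
by apply: le_trans (ler_normB _ _) _; exact: lerD.
Qed.

(** Once [k.+1%:R^-1 < eps], the exceptional set lies in the null set [N], so its outer variation is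
    eventually 0; uniform closeness gives the Cauchy condition in mean. *)
Lemma has_integral_uniform_approx mu f s v :
  ba mu -> nonneg_measure mu -> uniform_approx f s ->
  simple_integral mu (s k) @[k --> \oo] --> v -> has_integral mu f v.
Proof.
move=> bamu mu0 fs sv; have cmu := ba_nonneg_additive bamu mu0.
have dist := uniform_approx_dist fs.
have [N [g [bN N0 fg ss sg]]] := fs.
have T0 : 0 <= mu setT by apply: mu0; exact: borelT.
have T1 : 0 < mu setT + 1 by lra.
exists s; split => // [e e0|e e0].
  apply: cvg_near_cst; near=> k.
  apply: (outer_variation_null cmu bN (N0 _ bamu mu0)) => x /= ex.
  apply: contrapT => Nx; move: ex; rewrite fg // => /lt_le_trans /(_ (sg k x)).
  by apply/negP; rewrite -leNgt ltW //; near: k; exact: near_invnS_lt.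
(* Half for each of the indices [k] and [l]; the added 1 allows total mass 0 and makes the final
   inequality strict. *)
have c0 : 0 < e / (mu setT + 1) / 2 by rewrite !divr_gt0.
have [N1 _ hN1] := near_invnS_lt c0.
exists N1 => k l kN lN.
have sd : simple_map (fun x => `|s k x - s l x|).
  exact: (simple_map_comp2 (fun y z => `|y - z|) (ss k) (ss l)).
rewrite simple_integral_total_variation //.
apply: (@le_lt_trans _ _ (simple_integral mu (fun=> e / (mu setT + 1)))).
  apply: simple_integral_le => //; first exact: simple_map_cst.
  move=> x; apply: le_trans (dist k l x) _.
  rewrite [leRHS]splitr; apply: lerD; apply: ltW; exact: hN1.
rewrite simple_integral_cst // mulrAC ltr_pdivrMr // ltr_pM2l //; lra.
Unshelve. all: by end_near. Qed.

(** The error bound depends on [mu] only through its total mass, which later makes it uniform over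
    the normalised restrictions of [lambda]. *)
Lemma uniform_approx_integral mu f s :
  ba mu -> nonneg_measure mu -> uniform_approx f s ->
  simple_integral mu (s k) @[k --> \oo] --> integral_ba mu f /\
  forall k, `|integral_ba mu f - simple_integral mu (s k)| <=
            k.+1%:R^-1 * mu setT.
Proof.
move=> bamu mu0 fs; have cmu := ba_nonneg_additive bamu mu0.
have [N [g [_ _ _ ss _]]] := fs.
have T0 : 0 <= mu setT by apply: mu0; exact: borelT.
have T1 : 0 < mu setT + 1 by lra.
have dist k l : `|simple_integral mu (s k) - simple_integral mu (s l)| <=
    (k.+1%:R^-1 + l.+1%:R^-1) * mu setT.
  by apply: ler_dist_simple_integral => // x; exact: uniform_approx_dist fs k l x.
have small e : 0 < e -> \forall k \near \oo, k.+1%:R^-1 * mu setT <= e.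
  move=> e0; have c0 : 0 < e / (mu setT + 1) by rewrite divr_gt0.
  near=> k; apply: (@le_trans _ _ (e / (mu setT + 1) * mu setT)).
    by apply: ler_wpM2r => //; apply: ltW; near: k; exact: near_invnS_lt.
  by rewrite mulrAC ler_pdivrMr // ler_pM2l //; lra.
have cv : cvg (simple_integral mu (s k) @[k --> \oo]).
  apply: cauchy_cvg; apply: cauchy_exP => e e0.
  (* Two errors of at most [e / 3] stay strictly below [e]. *)
  have [N1 _ hN1] : \forall k \near \oo, k.+1%:R^-1 * mu setT <= e / 3.
    by apply: small; rewrite divr_gt0.
  exists (simple_integral mu (s N1)); exists N1 => //= k kN.
  apply: le_lt_trans (dist N1 k) _; rewrite mulrDl.
  by apply: le_lt_trans (lerD (hN1 N1 (leqnn _)) (hN1 k kN)) _; lra.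
have int : has_integral mu f (lim (simple_integral mu (s k) @[k --> \oo])).
  exact: has_integral_uniform_approx cv.
(* An integral exists, so [xget] does not return its default 0, and uniqueness identifies the value
   chosen. *)
have eq_int : integral_ba mu f = lim (simple_integral mu (s k) @[k --> \oo]).
  apply: (has_integral_unique cmu _ int).
  by rewrite /integral_ba; case: xgetP => [v _ //|/(_ _ int)].
rewrite -eq_int in cv; split => // k.
apply/ler_addgt0Pr => e e0; have e20 : 0 < e / 2 by rewrite divr_gt0.
near \oo => l.
have h1 : `|integral_ba mu f - simple_integral mu (s l)| <= e / 2.
  by near: l; exact: cvgr_dist_le cv _ e20.
have h2 : l.+1%:R^-1 * mu setT <= e / 2 by near: l; exact: small.
rewrite (_ : integral_ba mu f - simple_integral mu (s k) =
  (integral_ba mu f - simple_integral mu (s l)) +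
  (simple_integral mu (s l) - simple_integral mu (s k))); last by ring.
apply: le_trans (ler_normD _ _) _.
apply: (le_trans (lerD h1 (dist l k))).
by rewrite mulrDl addrA [leRHS]addrC lerD2r [leRHS]splitr lerD2l.
Unshelve. all: by end_near. Qed.

End integral_of_uniform_limits.

(** * Integration over a subset as integration against a restricted measure *)

Section restriction.
Context {R : realType} {n : nat} {Omega : set 'rV[R]_n}.
Implicit Types (mu : set Omega -> R) (f : Omega -> R) (s : nat -> Omega -> R).

Definition restr_measure mu (B : set Omega) := fun A => mu (A `&` B).

Lemma nonneg_restr_measure mu B :
  nonneg_measure mu -> borel B -> nonneg_measure (restr_measure mu B).
Proof. by move=> mu0 bB A bA; apply: mu0; exact: borelI. Qed.

Lemma ba_restr_measure mu B :
  ba mu -> nonneg_measure mu -> borel B -> ba (restr_measure mu B).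
Proof.
move=> bamu mu0 bB; have cmu := ba_nonneg_additive bamu mu0.
have [add [M hM] null] := bamu; split.
- move=> A C bA bC AC; rewrite /restr_measure setIUl add //;
    [exact: borelI|exact: borelI|].
  by rewrite setIACA AC set0I.
- by exists M => A bA; apply: hM; exact: borelI.
- move=> A bA A0; apply/eqP; rewrite eq_le nonneg_restr_measure // andbT.
  rewrite -(null A bA A0).
  exact: (nonneg_additive_le cmu (borelI bA bB) bA (@subIsetl _ _ _)).
Qed.

Lemma simple_integral_restr mu B (s : Omega -> R) :
  nonneg_additive mu -> nonneg_additive (restr_measure mu B) -> borel B ->
  simple_map s ->
  simple_integral mu (fun x => s x * \1_B x) =
  simple_integral (restr_measure mu B) s.
Proof.
move=> cmu cmuB bB ss.
have sw := simple_map_pair ss (simple_map_mem bB).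
rewrite (simple_integral_comp cmu (fun p : R * bool => p.1 * p.2%:R) sw).
rewrite (simple_integral_comp cmuB fst sw).
(* A fibre with second component [true] lies in [B]; with [false], the left term has factor 0 and on
   the right the fibre misses [B]. *)
apply: eq_fsbigr => -[y []] _ /=; rewrite /restr_measure.
  rewrite mulr1 setIidl // => x [_ xB]; exact: set_mem.
rewrite mulr0 mul0r (_ : _ `&` _ = set0) ?nonneg_additive0 ?mulr0 //.
by apply/seteqP; split => // x [[_ xB] /mem_set]; rewrite xB.
Qed.

Lemma uniform_approx_restr f s B : borel B -> uniform_approx f s ->
  uniform_approx (f \* \1_B) (fun k x => s k x * \1_B x).
Proof.
move=> bB [N [g [bN N0 fg ss sg]]].
exists N, (fun x => g x * \1_B x); split => // [x Nx|k|k x].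
- by rewrite /= fg.
- exact: (simple_map_comp2 *%R (ss k) (simple_map_indic bB)).
- rewrite -mulrBl normrM; apply: le_trans _ (sg k x); rewrite indicE.
  by rewrite ler_piMr //; case: (x \in B); rewrite ?normr1 ?normr0.
Qed.

(** Both sides are limits of the same simple integrals. Passing to the restriction replaces the
    total mass in the error bound by [mu B], which cancels against the normalisation of an
    average. *)
Lemma integral_ba_on_restr mu f s B :
  ba mu -> nonneg_measure mu -> borel B -> uniform_approx f s ->
  integral_ba_on mu B f = integral_ba (restr_measure mu B) f.
Proof.
move=> bamu mu0 bB fs; have cmu := ba_nonneg_additive bamu mu0.
have bar := ba_restr_measure bamu mu0 bB.
have r0 := nonneg_restr_measure mu0 bB.
have [c1 _] := uniform_approx_integral bar r0 fs.
have [c2 _] := uniform_approx_integral bamu mu0 (uniform_approx_restr bB fs).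
have [N [g [_ _ _ ss _]]] := fs.
have /funext eq_s : (fun k => simple_integral mu (fun x => s k x * \1_B x)) =1
    (fun k => simple_integral (restr_measure mu B) (s k)).
  move=> k; apply: simple_integral_restr => //; exact: ba_nonneg_additive.
by apply: cvg_unique c2 _ => //; rewrite eq_s.
Qed.

End restriction.

(** * Limits along ultrafilters, and lower and upper limits *)

Section limits.
Context {R : realType}.

(** If [A] belongs to a finer proper filter but its preimage is not in [F], then the preimage of its
    complement is in [F], so the finer filter contains two disjoint sets. *)
Lemma ultra_fmap (T U : Type) (f : T -> U) (F : set_system T) :
  UltraFilter F -> UltraFilter (f @ F).
Proof.
move=> FU; split => [|G GF sFG]; first exact: fmap_proper_filter.
apply/seteqP; split => // A GA.
have [//|FnA] := in_ultra_setVsetC (f @^-1` A) FU.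
have GnA : G (~` A) by exact: sFG.
by have /filter_ex[x []] : G (A `&` ~` A) by exact: filterI.
Qed.

(** Compactness of the segment from [a] to [b], in its ultrafilter form. *)
Lemma ultra_bounded_cvg (T : Type) (f : T -> R) (F : set_system T) (a b : R) :
  UltraFilter F -> F [set t | a <= f t <= b] -> cvg (f @ F).
Proof.
move=> FU Fab; have := @segment_compact R a b.
rewrite compact_ultra => /(_ _ (ultra_fmap f FU)) [|l [_ fl]].
  rewrite /fmap /=; apply: filterS Fab => t /=.
  by rewrite in_itv.
by apply/cvg_ex; exists l.
Qed.

(** Each [V] in [F] also lies in [G], hence meets the set where [g] is at most [l + e]; so the
    infimum over [V] is at most [l + e]. *)
Lemma limf_einf_le_cvg (g : R -> R) (F G : set_system R) (l : R) :
  ProperFilter G -> F `<=` G -> g @ G --> l ->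
  (limf_einf (fun x => (g x)%:E) F <= l%:E)%E.
Proof.
move=> GF FG gl; rewrite limf_einfE; apply: ge_ereal_sup => _ [V FV <-].
apply/lee_addgt0Pr => e e0.
have GV : G V := FG _ FV.
have Gle : \forall x \near G, g x <= l + e by apply: (cvgr_le _ gl); rewrite ltrDl.
have [x [Vx gx]] := filter_ex (filterI GV Gle).
apply: (@le_trans _ _ (g x)%:E); last by rewrite -EFinD lee_fin.
by apply: ereal_inf_lbound; exists x.
Qed.

Lemma limf_esup_ge_cvg (g : R -> R) (F G : set_system R) (l : R) :
  ProperFilter G -> F `<=` G -> g @ G --> l ->
  (l%:E <= limf_esup (fun x => (g x)%:E) F)%E.
Proof.
move=> GF FG gl; rewrite -leeN2 -limf_einfN.
apply: (limf_einf_le_cvg (g := fun x => - g x) GF FG).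
exact: cvgN.
Qed.

End limits.

(** * Simple integrals under setwise convergence *)

Section simple_integral_limit.
Context {R : realType} {n : nat} {Omega : set 'rV[R]_n}.

Lemma cvg_simple_integral (T : Type) (F : set_system T) (m : T -> set Omega -> R)
    (mu : set Omega -> R) (s : Omega -> R) : Filter F -> simple_map s ->
  (forall A, borel A -> m t A @[t --> F] --> mu A) ->
  simple_integral (m t) s @[t --> F] --> simple_integral mu s.
Proof.
move=> FF [fs bs] mmu; rewrite /simple_integral fsbig_finite //.
under eq_fun do rewrite fsbig_finite //.
apply: cvg_big; first exact: add_continuous.
by move=> x _; apply: cvgM; [exact: cvg_cst|exact: mmu].
Qed.

End simple_integral_limit.

(** * Construction of the density measure and comparison with the averages *)

Theorem proposition5p7 (R : realType) (n : nat) (Omega F : set 'rV[R]_n)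
    (lambda : set Omega -> R) :
  borel Omega -> closed F -> F `<=` closure Omega ->
  lebesgue_rV (F `&` Omega) = 0%E ->
  ba lambda -> nonneg_measure lambda ->
  (forall delta : R, 0 < delta -> 0 < lambda (nbhd_on F delta)) ->
  exists2 mu : set Omega -> R, density_measure F mu &
    forall f : Omega -> R, Linfty f -> forall delta : R, 0 < delta ->
      [/\ integral_ba_on mu (nbhd_on F delta) f = integral_ba mu f,
          (limf_einf (fun d : R => (average lambda (nbhd_on F d) f)%:E) 0^'+
             <= (integral_ba_on mu (nbhd_on F delta) f)%:E)%E &
          ((integral_ba_on mu (nbhd_on F delta) f)%:E
             <= limf_esup (fun d : R => (average lambda (nbhd_on F d) f)%:E)
                          0^'+)%E].
Proof.
move=> _ _ _ _ balam lam0 lampos.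
have clam := ba_nonneg_additive balam lam0.
have bFd d : borel (nbhd_on F d : set Omega) by exact: borel_nbhd_on.
have [U [UU sU]] := @ultraFilterLemma R (0^'+) _.
pose m (d : R) A := (lambda (nbhd_on F d))^-1 * restr_measure lambda (nbhd_on F d) A.
have Upos : \forall d \near U, 0 < d by apply: sU; exact: nbhs_right_gt.
(* For [A] not Borel the limit may fail to exist and [lim] may be a default value; such values of
   [mu] are irrelevant. *)
pose mu A := lim (m d A @[d --> U]).
have m01 d A : 0 < d -> borel A -> 0 <= m d A <= 1.
  move=> d0 bA; have lp := lampos d d0; rewrite /m /restr_measure.
  rewrite mulr_ge0 /=; first last.
  - by apply: lam0; exact: borelI.
  - by rewrite invr_ge0 ltW.
  rewrite ler_pdivrMl // mulr1.
  exact: (nonneg_additive_le clam (borelI bA (bFd d)) (bFd d) (@subIsetr _ _ _)).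
have mmu A : borel A -> m d A @[d --> U] --> mu A.
  move=> bA; apply: (@ultra_bounded_cvg _ _ _ _ 0 1) => //.
  by apply: filterS Upos => d d0; exact: m01.
have mu_near A c : borel A -> (\forall d \near U, m d A = c) -> mu A = c.
  move=> bA mc; apply: (cvg_unique _ (mmu A bA)) => //.
  exact: cvg_near_cst.
(* For [d < e] the set [A] contains the whole neighbourhood of radius [d], so [m d A] is exactly 1.
   This yields the mass of every neighbourhood and of [setT]. *)
have mu1 A (e : R) : borel A -> 0 < e -> nbhd_on F e `<=` A -> mu A = 1.
  move=> bA e0 eA; apply: mu_near => //.
  have Ue : \forall d \near U, d < e by apply: sU; exact: nbhs_right_lt.
  near=> d; have d0 : 0 < d by near: d.
  rewrite /m /restr_measure setIidr ?mulVf ?gt_eqF ?lampos //.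
  apply: subset_trans eA; move=> x; apply: eucl_nbhd_subset.
  by apply: ltW; near: d.
have mu0 : nonneg_measure mu.
  move=> A bA; apply: (limr_ge _); first exact: mmu.
  by apply: filterS Upos => d d0; have /andP[] := m01 d A d0 bA.
have bamu : ba mu.
  have [add _ null] := balam; split.
  - move=> A B bA bB AB.
    apply: (cvg_unique _ (mmu _ (borelU bA bB))) => //.
    rewrite (_ : (fun d => m d (A `|` B)) = (fun d => m d A + m d B)).
      by apply: cvgD; exact: mmu.
    apply/funext => d; rewrite /m.
    have [addr _ _] := ba_restr_measure balam lam0 (bFd d).
    by rewrite addr // mulrDr.
  - exists 1 => A bA; rewrite ger0_norm ?mu0 //.
    apply: limr_le; first exact: mmu.
    by apply: filterS Upos => d d0; have /andP[] := m01 d A d0 bA.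
  - move=> A bA A0; apply: mu_near => //; near=> d; rewrite /m.
    have [_ _ nullr] := ba_restr_measure balam lam0 (bFd d).
    by rewrite nullr // mulr0.
have muT : mu setT = 1 by apply: (mu1 _ 1) => //; exact: borelT.
exists mu.
  by split => // d d0; exact: (mu1 _ d).
move=> f /Linfty_uniform_approx[s fs] delta delta0.
have [N [g [_ _ _ ss _]]] := fs.
(* [mu] has no mass outside [nbhd_on F delta], so [mu] and its restriction give each [s k] the same
   integral. *)
have restr_eq : integral_ba_on mu (nbhd_on F delta) f = integral_ba mu f.
  rewrite (integral_ba_on_restr bamu mu0 (bFd delta) fs).
  have [c1 _] := uniform_approx_integral (ba_restr_measure bamu mu0 (bFd delta))
    (nonneg_restr_measure mu0 (bFd delta)) fs.
  have [c2 _] := uniform_approx_integral bamu mu0 fs.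
  apply: (cvg_unique _ c1) => //.
  rewrite (_ : (fun k =>
      simple_integral (restr_measure mu (nbhd_on F delta)) (s k)) =
    (fun k => simple_integral mu (s k))) //.
  apply/funext => k; apply: eq_fsbigr => x _; congr (_ * _); rewrite /restr_measure.
  have [_ bsk] := ss k.
  have cmu := ba_nonneg_additive bamu mu0.
  have bAF := borelI (bsk x) (bFd delta).
  rewrite [RHS](nonneg_additiveD cmu bAF (bsk x) (@subIsetl _ _ _)).
  (* The rest of the fibre misses [nbhd_on F d] for every [d < delta], so [m d] vanishes on it for
     small [d]. *)
  rewrite (_ : mu (_ `\` _) = 0) ?addr0 //.
  apply: mu_near; first by rewrite setDE; apply: borelI => //; exact: borelC.
  have Ue : \forall d \near U, d < delta by apply: sU; exact: nbhs_right_lt.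
  near=> d; rewrite /m /restr_measure (_ : _ `&` _ = set0).
    by rewrite nonneg_additive0 // mulr0.
  apply/seteqP; split => // y [[sy nF] Fd]; apply: nF; split => //.
  by apply: eucl_nbhd_subset Fd; apply: ltW; near: d.
(* Three errors of [e / 3], with [k] fixed before [d]: from [f] to [s k] under [mu], from [mu] to
   [m d] on [s k], and from [s k] back to [f] under [m d]. *)
have avg_cvg : average lambda (nbhd_on F d) f @[d --> U] --> integral_ba mu f.
  apply/cvgrPdist_le => e e0; have e30 : 0 < e / 3 by rewrite divr_gt0.
  have [k _ /(_ k (leqnn k)) hk] := near_invnS_lt e30.
  have [_ /(_ k)] := uniform_approx_integral bamu mu0 fs.
  rewrite muT mulr1 => /le_trans/(_ (ltW hk)) h1.
  have h2U : \forall d \near U,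
      `|simple_integral mu (s k) - simple_integral (m d) (s k)| <= e / 3.
    have cJ : simple_integral (m d) (s k) @[d --> U] --> simple_integral mu (s k).
      exact: cvg_simple_integral.
    by apply: cvgr_dist_le; [exact: cJ|].
  near=> d; have d0 : 0 < d by near: d.
  have lp := lampos d d0.
  have h2 : `|simple_integral mu (s k) - simple_integral (m d) (s k)| <= e / 3.
    by near: d; exact: h2U.
  have [_ /(_ k) h3] := uniform_approx_integral (ba_restr_measure balam lam0 (bFd d))
    (nonneg_restr_measure lam0 (bFd d)) fs.
  rewrite /average (integral_ba_on_restr balam lam0 (bFd d) fs).
  set I := integral_ba (restr_measure _ _) f in h3 *.
  set J := simple_integral (restr_measure _ _) _ in h3.
  have mJ : simple_integral (m d) (s k) = (lambda (nbhd_on F d))^-1 * J.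
    rewrite /J /simple_integral mulr_fsumr; apply: eq_fsbigr => x _.
    by rewrite mulrCA.
  (* Dividing by the mass of the neighbourhood cancels the total mass of the restriction, so the
     choice of [k] works for all [d]. *)
  have {}h3 :
      `|(lambda (nbhd_on F d))^-1 * I - simple_integral (m d) (s k)| <= e / 3.
    rewrite mJ -mulrBr normrM gtr0_norm ?invr_gt0 // ler_pdivrMl //.
    apply: le_trans h3 _; rewrite /restr_measure setTI mulrC ler_pM2l //.
    exact: ltW.
  rewrite (_ : integral_ba mu f - _ = (integral_ba mu f - simple_integral mu (s k)) +
    (simple_integral mu (s k) - simple_integral (m d) (s k)) -
    ((lambda (nbhd_on F d))^-1 * I - simple_integral (m d) (s k))); last by ring.
  apply: le_trans (ler_normB _ _) _.
  apply: le_trans (lerD (le_trans (ler_normD _ _) (lerD h1 h2)) h3) _.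
  by lra.
rewrite restr_eq; split => //.
  exact: limf_einf_le_cvg sU avg_cvg.
exact: limf_esup_ge_cvg sU avg_cvg.
Unshelve. all: by end_near. Qed.
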